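(* For each integer $e \geq 2$ there is a regular graph $G \in \mathcal{W}_5$ on exactly $2^{2^{e}-1}$ vertices. That is, there exists a regular graph $G$ with $2^{2^e-1}$ vertices which has diameter $2$, contains no triangle and no (not necessarily induced) subgraph isomorphic to $K_{2,5}$, and is not a star.
   Context: All graphs are finite and simple. For an integer $t \ge 1$, $\mathcal{W}_t$ denotes the class of graphs other than stars (graphs $K_{1,m}$) that have diameter $2$ and contain neither a triangle $C_3$ nor a $K_{2,t}$ as a subgraph. The diameter of a graph is the maximum distance between two of its vertices. *)

(* Defs.v *)
From mathcomp Require Import all_boot.

Set Implicit Arguments.
Unset Strict Implicit.
Unset Printing Implicit Defensive.

Record sgraph := SGraph {
  vertex :> finType;
  adj : rel vertex;
  adj_sym : symmetric adj;
  adj_irrefl : irreflexive adj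
}.

Definition embeds (H G : sgraph) : Prop :=
  exists f : H -> G,
    injective f /\ forall x y, @adj H x y -> @adj G (f x) (f y).

Definition isomorphic (H G : sgraph) : Prop :=
  exists f : H -> G,
    bijective f /\ forall x y, @adj H x y = @adj G (f x) (f y).

Definition cycle_adj (n : nat) : rel 'I_n :=
  fun i j => (i != j) && ((ordS i == j) || (ordS j == i)).

Lemma cycle_adj_sym n : symmetric (@cycle_adj n).
Proof. by move=> i j; rewrite /cycle_adj eq_sym orbC. Qed.

Lemma cycle_adj_irrefl n : irreflexive (@cycle_adj n).
Proof. by move=> i; rewrite /cycle_adj eqxx. Qed.

(* This is the cycle C_n only for n >= 3. *)
Definition cycle_graph (n : nat) : sgraph :=
  SGraph (@cycle_adj_sym n) (@cycle_adj_irrefl n).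

Definition bip_adj (m n : nat) : rel ('I_m + 'I_n) :=
  fun u v => match u, v with
             | inl _, inr _ | inr _, inl _ => true
             | _, _ => false
             end.

Lemma bip_adj_sym m n : symmetric (@bip_adj m n).
Proof. by case=> ? [?|?]. Qed.

Lemma bip_adj_irrefl m n : irreflexive (@bip_adj m n).
Proof. by case. Qed.

Definition complete_bipartite (m n : nat) : sgraph :=
  SGraph (@bip_adj_sym m n) (@bip_adj_irrefl m n).

Definition is_star (G : sgraph) : Prop :=
  exists m : nat, isomorphic (complete_bipartite 1 m) G.

Definition regular (G : sgraph) : Prop :=
  exists k : nat, forall x : G, #|[set y | adj x y]| = k.

Definition walk (G : sgraph) (x y : G) (k : nat) : Prop :=
  exists p : seq G, [/\ path (@adj G) x p, last x p = y & size p = k].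

(* No k satisfies this when x and y lie in different components. *)
Definition has_distance (G : sgraph) (x y : G) (k : nat) : Prop :=
  walk x y k /\ forall j, walk x y j -> k <= j.

(* All distances are finite and their maximum is d; in particular, a
   disconnected graph has no diameter in this sense. *)
Definition has_diameter (G : sgraph) (d : nat) : Prop :=
  (forall x y : G, exists2 k, has_distance x y k & k <= d) /\
  (exists x y : G, has_distance x y d).

Definition in_W (t : nat) (G : sgraph) : Prop :=
  [/\ ~ is_star G,
      has_diameter G 2,
      ~ embeds (cycle_graph 3) G
    & ~ embeds (complete_bipartite 2 t) G].

(* Main.v *)
(** Crooked graphs, recursively refined.  Let [q = 2 ^ n] with [n] odd, so that
    [GF(q)] contains no primitive cube root of unity.  On [U = GF(q) * bool] put
      [F (a, i) (b, j) = a^2 b + a b^2 + [i != j] (a^3 + b^3)].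
    For distinct [u], [v] the map [w |-> F u w + F v w] is exactly 2-to-1 onto
    [GF(q)].  Hence in the graph of de Caen, Mathon and Moorhouse on [U * GF(q)],
    where [(u, x)] and [(v, y)] are adjacent iff [u <> v] and [x + y = F u v],
    vertices in distinct fibres have no common neighbour if they are adjacent and
    exactly two otherwise, while two vertices of one fibre have none.  Placing in
    every fibre a regular triangle-free graph of diameter at most 2 with
    codegrees at most 4 adds at most two common neighbours to nonadjacent
    vertices of distinct fibres, so all these properties persist while the order
    goes from [q] to [2 q ^ 2].  Start from [K_2]. *)

Require Import Defs.
From mathcomp Require Import all_boot.
From mathcomp Require Import all_order all_algebra all_field.
From mathcomp Require Import ring zify.

Set Implicit Arguments.
Unset Strict Implicit.
Unset Printing Implicit Defensive.

Import GRing.Theory.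

(** Pigeonhole: the fibres have average size [k], so if none exceeds [k], none falls short. *)
Lemma fiber_card_eq (A B : finType) (f : A -> B) (k : nat) :
  #|A| = k * #|B| -> (forall b, #|[set a | f a == b]| <= k) ->
  forall b, #|[set a | f a == b]| = k.
Proof.
move=> cardA le_k b; apply/eqP; rewrite eqn_leq le_k /= leqNgt; apply/negP => lt_k.
have cardAE : #|A| = \sum_(c : B) #|[set a | f a == c]|.
  rewrite -sum1_card (partition_big f predT) //=; apply: eq_bigr => c _.
  by rewrite -sum1_card; apply: eq_bigl => a; rewrite inE.
have : \sum_(c : B) #|[set a | f a == c]| < \sum_(c : B) k.
  rewrite (bigD1 b) //= [X in _ < X](bigD1 b) //= -addSn leq_add //.
  by apply: leq_sum.
by rewrite -cardAE sum_nat_const cardA mulnC ltnn.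
Qed.

(** * The crooked kernel *)

Section Kernel.

Local Open Scope ring_scope.

Variable F : finFieldType.
Hypothesis char2 : 2%N \in [pchar F].
Hypothesis no_cube_root : forall x : F, x ^+ 2 + x + 1 != 0.

Let two0 : 2%:R = 0 :> F. Proof. exact: (pcharf0 char2). Qed.

Lemma add_eq0_pchar2 (x y : F) : (x + y == 0) = (x == y).
Proof. by rewrite -{1}(oppr_pchar2 char2 y) subr_eq0. Qed.

(** Otherwise [x / y] would be a root of X^2 + X + 1. *)
Lemma norm_form_eq0 (x y : F) : x ^+ 2 + x * y + y ^+ 2 = 0 -> y = 0.
Proof.
move=> xy0; apply/eqP; apply: contraT => y0.
have /eqP[] := no_cube_root (x / y).
rewrite -[RHS](mul0r (y ^+ 2)^-1) -xy0; field; exact: y0.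
Qed.

Lemma cube_inj : injective (fun x : F => x ^+ 3).
Proof.
move=> x y /= xy3; apply/eqP; rewrite -subr_eq0.
have /eqP : (x - y) * (x ^+ 2 + x * y + y ^+ 2) = 0.
  by transitivity (x ^+ 3 - y ^+ 3); [ring | rewrite xy3 subrr].
rewrite mulf_eq0 => /orP[// | /eqP nf0].
have y0 := norm_form_eq0 nf0; move: xy3; rewrite y0 expr0n /= => /eqP.
by rewrite expf_eq0 /= => /eqP ->; rewrite subrr.
Qed.

Definition crooked (u v : F * bool) : F :=
  u.1 ^+ 2 * v.1 + u.1 * v.1 ^+ 2 + (u.2 != v.2)%:R * (u.1 ^+ 3 + v.1 ^+ 3).

Lemma crooked_sym u v : crooked u v = crooked v u.
Proof. by rewrite /crooked (eq_sym u.2); ring. Qed.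

Lemma crooked_diag u : crooked u u = 0.
Proof.
rewrite /crooked eqxx mul0r addr0 -exprSr -exprS.
exact: (addrr_pchar2 char2).
Qed.

Lemma crooked_fiber_le2 (u v : F * bool) (c : F) :
  u != v -> leq #|[set w | crooked u w + crooked v w == c]| 2.
Proof.
case: u v => a i [b j] neq_uv; set D := [set w | _].
have DE z k : (z, k) \in D -> c = crooked (a, i) (z, k) + crooked (b, j) (z, k).
  by rewrite inE => /eqP.
have [eq_ij | neq_ij] := eqVneq i j; last first.
  (* Up to a constant, the map is [z |-> (z + a + b) ^+ 3] on each half. *)
  rewrite -card_bool -(card_in_imset (f := snd)); first exact: max_card.
  move=> [z k] [z' k'] /DE cz /DE cz' /= eq_k; subst k'; congr (_, _).
  apply: (addIr (a + b)); apply: cube_inj => /=.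
  (* [e] belongs to whichever of [u], [v] lies in the half opposite to [k]; only that one
     contributes cubes. *)
  set e := if i == k then b else a.
  have cubeE t : (t + (a + b)) ^+ 3
      = crooked (a, i) (t, k) + crooked (b, j) (t, k) + ((a + b) ^+ 3 - e ^+ 3).
    rewrite /e /crooked /=.
    have -> : (j != k) = (i == k) by case: (i) (j) (k) neq_ij => [] [] [].
    (* [ring] does not see the characteristic, so the discrepancy between the two sides is supplied
       as an explicit multiple of 2. *)
    rewrite -[RHS]addr0.
    rewrite -[X in _ = _ + X](mul0r (t ^+ 2 * (a + b) + t * (a + b) ^+ 2 + a * b * t)).
    by rewrite -two0; case: (i == k) => /=; ring.
  by rewrite !cubeE -cz -cz'.
have [-> | [[z k] zD]] := set_0Vmem D; first by rewrite cards0.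
have neq_ab : a + b != 0.
  by rewrite add_eq0_pchar2; apply: contraNneq neq_uv => ->; rewrite eq_ij.
(* One solution leaves a single other candidate, its translate by [a + b] in the same half. *)
suff /subset_leq_card/leq_trans : D \subset [set (z, k); (z + (a + b), k)].
  by apply; rewrite cards2; case: (_ != _).
apply/subsetP => -[z' k'] z'D; rewrite !inE !xpair_eqE -eq_ij in neq_uv *.
have := DE _ _ z'D; rewrite (DE _ _ zD) /crooked /= -eq_ij => eqc.
pose h := z + z'.
have quad0 : (a + b) * (h ^+ 2 + (a + b) * h
    + (k != k')%:R * (a ^+ 2 + a * b + b ^+ 2)) = 0.
  move/eqP: eqc; rewrite -add_eq0_pchar2 => /eqP eqc.
  pose l := (i != k)%:R : F; pose l' := (i != k')%:R : F.
  (* Exclusive or of the bits as a polynomial, so that [ring] can treat it. *)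
  have -> : (k != k')%:R = l + l' - 2%:R * (l * l').
    by rewrite /l /l'; case: (i) (k) (k') => [] [] [] /=; ring.
  rewrite -(addr0 0) -{1}eqc.
  rewrite -(mul0r (a * b * h + (a + b) * (z * z')
    + (l + l' - 2%:R * (l * l')) * (a ^+ 2 * b + a * b ^+ 2)
    - l * l' * (a ^+ 3 + b ^+ 3) - l * z ^+ 3 - l' * z' ^+ 3)).
  by rewrite -two0 /h -/l -/l'; ring.
move/eqP: quad0; rewrite mulf_eq0 (negPf neq_ab) /= => /eqP quad0.
(* For solutions in opposite halves the quadratic is the norm form at [h + a] and [a + b], forcing
   [a + b = 0]. In the same half it is [h * (h + a + b)]. *)
have [eq_k | neq_k] := eqVneq k k'; last first.
  case/eqP: neq_ab; apply: (@norm_form_eq0 (h + a)).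
  rewrite -quad0 neq_k mul1r.
  rewrite -[RHS]addr0 -[X in _ = _ + X](mul0r (a * h + a ^+ 2 + a * b)) -two0.
  by ring.
move: quad0; rewrite eq_k eqxx mul0r addr0 => /eqP.
rewrite !andbT expr2 -mulrDl mulf_eq0 !add_eq0_pchar2 orbC.
rewrite eq_sym => /orP[-> // | /eqP <-]; apply/orP; right.
by rewrite /h addrA (addrr_pchar2 char2) add0r.
Qed.

Lemma crooked_fiber_card (u v : F * bool) (c : F) :
  u != v -> #|[set w | crooked u w + crooked v w == c]| = 2%N.
Proof.
move=> neq_uv; apply: (fiber_card_eq (f := fun w => crooked u w + crooked v w)).
  by rewrite card_prod card_bool mulnC.
by move=> b; apply: crooked_fiber_le2.
Qed.

End Kernel.

(** For odd [n], q = 2^n is 2 modulo 3. A root [x] satisfies x^3 = 1, so x = x^q = x^2, and the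
    equation collapses to 1 = 0. *)
Lemma exists_crooked_field (n : nat) : odd n ->
  exists F : finFieldType, [/\ #|F| = 2 ^ n, 2 \in [pchar F]%R
    & forall x : F, (x ^+ 2 + x + 1 != 0)%R].
Proof.
move=> odd_n; have n_gt0 : 0 < n by case: n odd_n.
have [F charF cardF] := pPrimePowerField (isT : prime 2) n_gt0.
exists F; split=> // x; apply/eqP => x0.
have x3 : (x ^+ 3 = 1)%R.
  apply/eqP; rewrite -subr_eq0.
  have -> : (x ^+ 3 - 1 = (x - 1) * (x ^+ 2 + x + 1))%R by ring.
  by rewrite x0 mulr0.
have q_mod3 : 2 ^ n = 3 * (2 ^ n %/ 3) + 2.
  rewrite {1}(divn_eq (2 ^ n) 3) mulnC; congr (_ + _).
  rewrite -(odd_double_half n) odd_n expnD -mul2n expnM -modnMmr -modnXm.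
  by rewrite exp1n.
have := expf_card x; rewrite cardF q_mod3 exprD exprM x3 expr1n mul1r => x2.
move: x0; rewrite x2 (addrr_pchar2 charF) add0r => /eqP.
by rewrite oner_eq0.
Qed.

(** * Inflating a graph along the crooked kernel *)

Definition triangle_free (G : sgraph) : Prop :=
  forall x y z : G, adj x y -> adj y z -> ~~ adj x z.

Definition codegree_le (k : nat) (G : sgraph) : Prop :=
  forall x y : G, x != y -> #|[set z | adj x z && adj y z]| <= k.

Definition diameter_le2 (G : sgraph) : Prop :=
  forall x y : G, x != y -> ~~ adj x y -> exists z, adj x z && adj y z.

Section Inflation.

Variables (F : finFieldType) (G : sgraph) (phi : G -> F).
Hypothesis char2 : 2 \in [pchar F]%R.
Hypothesis no_cube_root : forall x : F, (x ^+ 2 + x + 1 != 0)%R.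
Hypothesis phi_bij : bijective phi.

(** Taking [G] itself as second coordinate puts a copy of [G] in each fibre; [phi] merely labels its
    vertices by field elements and need not respect adjacency. *)
Definition infl_adj : rel (F * bool * G) := fun x y =>
  if x.1 == y.1 then adj x.2 y.2
  else (phi x.2 + phi y.2 == crooked x.1 y.1)%R.

Lemma infl_adj_sym : symmetric infl_adj.
Proof.
move=> x y; rewrite /infl_adj eq_sym adj_sym crooked_sym.
by rewrite [(phi x.2 + _)%R]addrC.
Qed.

Lemma infl_adj_irrefl : irreflexive infl_adj.
Proof. by move=> x; rewrite /infl_adj eqxx adj_irrefl. Qed.

Definition inflation : sgraph := SGraph infl_adj_sym infl_adj_irrefl.

Let addK2 (x y z : F) : (x + y == z)%R = (y == x + z)%R.
Proof.
by rewrite -(inj_eq (addrI x)) addrA (addrr_pchar2 char2) add0r.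
Qed.

Lemma infl_adj_neq (u w : F * bool) (a g : G) : u != w ->
  @adj inflation (u, a) (w, g) = (phi g == phi a + crooked u w)%R.
Proof. by move=> neq_uw; rewrite /= /infl_adj /= (negPf neq_uw) addK2. Qed.

Lemma infl_adj_same (u : F * bool) (a g : G) :
  @adj inflation (u, a) (u, g) = adj a g.
Proof. by rewrite /= /infl_adj eqxx. Qed.

(** Between two distinct fibres the edges form a perfect matching, so vertices of one fibre share
    neighbours only inside it. *)
Lemma infl_common_same (u w : F * bool) (a b g : G) : a != b ->
  @adj inflation (u, a) (w, g) -> @adj inflation (u, b) (w, g) ->
  [/\ u = w, adj a g & adj b g].
Proof.
move=> neq_ab.
have [<- | neq_uw] := eqVneq u w; first by rewrite !infl_adj_same.
rewrite !infl_adj_neq // => /eqP-> /eqP/addIr/(bij_inj phi_bij) eq_ab.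
by rewrite eq_ab eqxx in neq_ab.
Qed.

(** Outside the fibres of [u] and [v], the kernel equation selects [w], and then [g] is
    determined. *)
Lemma infl_common_neq (u v w : F * bool) (a b g : G) : u != w -> v != w ->
  @adj inflation (u, a) (w, g) && @adj inflation (v, b) (w, g)
  = (phi g == phi a + crooked u w)%R
    && (crooked u w + crooked v w == phi a + phi b)%R.
Proof.
move=> neq_uw neq_vw; rewrite !infl_adj_neq //; apply: andb_id2l => /eqP->.
rewrite eq_sym !addK2; congr (_ == _); ring.
Qed.

Lemma infl_triangle_free : triangle_free G -> triangle_free inflation.
Proof.
move=> tfG [u a] [v b] [w c] xy; rewrite adj_sym => zy; apply/negP => xz.
have [eq_uv | neq_uv] := eqVneq u v.
  subst v; have neq_ab : a != b.
    by apply: contraTneq xy => ->; rewrite adj_irrefl.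
  rewrite adj_sym in zy; have [eq_uw ac bc] := infl_common_same neq_ab xz zy.
  by move: xy; rewrite infl_adj_same => ab; have /negP[] := tfG _ _ _ ab bc.
have common_z : @adj inflation (u, a) (w, c) && @adj inflation (v, b) (w, c).
  by rewrite xz adj_sym.
have [eq_uw | neq_uw] := eqVneq u w.
  subst w; have neq_ac : a != c.
    by apply: contraTneq xz => ->; rewrite adj_irrefl.
  by have [eq_uv] := infl_common_same neq_ac xy zy; rewrite eq_uv eqxx in neq_uv.
have [eq_vw | neq_vw] := eqVneq v w.
  subst w; have neq_cb : b != c.
    by apply: contraTneq zy => ->; rewrite adj_irrefl.
  rewrite adj_sym in xy; rewrite adj_sym in xz.
  by have [eq_uv] := infl_common_same neq_cb xy xz; rewrite eq_uv eqxx in neq_uv.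
move: common_z; rewrite infl_common_neq // => /andP[_ w_fib].
(* [u] and [v] already exhaust the fibre of the kernel over [crooked u v]. *)
move: xy; rewrite infl_adj_neq // -addK2 => /eqP eq_c; rewrite eq_c in w_fib.
have := crooked_fiber_card char2 no_cube_root (crooked u v) neq_uv.
apply/eqP; rewrite neq_ltn; apply/orP; right.
have <- : #|[set u; v; w]| = 3.
  by rewrite setUC cardsU1 cards2 !inE neq_uv negb_or !(eq_sym w) neq_uw neq_vw.
apply/subset_leq_card/subsetP => t; rewrite !inE -orbA => /or3P[] /eqP-> //.
  by rewrite crooked_diag // add0r crooked_sym.
by rewrite crooked_diag // addr0.
Qed.

Lemma infl_codegree_le : codegree_le 4 G -> codegree_le 4 inflation.
Proof.
move=> cdG [u a] [v b] neq_xy; set D := [set z | _].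
have [eq_uv | neq_uv] := eqVneq u v.
  subst v; have neq_ab : a != b by apply: contraNneq neq_xy => ->.
  have DE w g : (w, g) \in D -> [/\ u = w, adj a g & adj b g].
    by rewrite inE => /andP[]; apply: infl_common_same.
  apply: leq_trans (cdG _ _ neq_ab); rewrite -(card_in_imset (f := snd)).
    apply/subset_leq_card/subsetP => _ /imsetP[[w g] /DE[_ ag bg] ->].
    by rewrite inE ag.
  by move=> [w g] [w' g'] /DE[<- _ _] /DE[<- _ _] /= ->.
have := crooked_fiber_card char2 no_cube_root (phi a + phi b)%R neq_uv.
set E := [set w | _] => cardE.
rewrite -(card_in_imset (f := fst)).
  (* Each fibre holds at most one common neighbour, and only the fibres of [u], [v] and the two
     points of [E] can hold one: 2 + 2 = 4. *)
  suff /subset_leq_card/leq_trans: fst @: D \subset [set u; v] :|: E.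
    apply; apply: leq_trans (leq_card_setU _ _) _.
    by rewrite cards2 neq_uv cardE.
  apply/subsetP => t /imsetP[[w g]]; rewrite inE => zD -> /=; rewrite !inE.
  have [//|neq_wu] := eqVneq w u; have [//|neq_wv] := eqVneq w v.
  by move: zD; rewrite infl_common_neq 1?eq_sym // => /andP[].
move=> [w g] [w' g']; rewrite !inE => zD zD' /= eq_w; subst w'.
congr (_, _); apply: (bij_inj phi_bij).
have [eq_uw | neq_uw] := eqVneq u w.
  subst w; move: zD zD' => /andP[_ +] /andP[_].
  by rewrite !infl_adj_neq 1?eq_sym // => /eqP-> /eqP->.
move: zD zD' => /andP[+ _] /andP[+ _].
by rewrite !infl_adj_neq // => /eqP-> /eqP->.
Qed.

Lemma infl_diameter_le2 : diameter_le2 G -> diameter_le2 inflation.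
Proof.
move=> dG [u a] [v b] neq_xy nadj_xy.
have [eq_uv | neq_uv] := eqVneq u v.
  subst v; rewrite infl_adj_same in nadj_xy.
  have neq_ab : a != b by apply: contraNneq neq_xy => ->.
  have [g gP] := dG _ _ neq_ab nadj_xy.
  by exists (u, g); rewrite !infl_adj_same.
have := crooked_fiber_card char2 no_cube_root (phi a + phi b)%R neq_uv.
set E := [set w | _] => cardE.
have [w wE] : exists w, w \in E by apply/card_gt0P; rewrite cardE.
rewrite inE in wE; rewrite infl_adj_neq // -addK2 eq_sym in nadj_xy.
(* If [w] were [u] or [v], then [phi a + phi b] would equal [crooked u v], making the two vertices
   adjacent. *)
have neq_uw : u != w.
  apply: contraNneq nadj_xy => eq_uw.
  by rewrite -(eqP wE) -eq_uw crooked_diag // add0r crooked_sym.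
have neq_vw : v != w.
  apply: contraNneq nadj_xy => eq_vw.
  by rewrite -(eqP wE) -eq_vw crooked_diag // addr0.
have [psi _ phiK] := phi_bij.
exists (w, psi (phi a + crooked u w)%R).
by rewrite infl_common_neq // phiK eqxx.
Qed.

Lemma infl_regular : regular G -> regular inflation.
Proof.
case=> k degG; exists (k + #|{: F * bool}|.-1) => -[u a].
have [psi psiK phiK] := phi_bij.
(* The neighbours are those within the fibre and exactly one in every other fibre. *)
have -> : [set y | @adj inflation (u, a) y]
    = [set (u, g) | g in [set g | adj a g]]
      :|: [set (w, psi (phi a + crooked u w)%R) | w in [set~ u]].
  apply/setP => -[w g]; rewrite !inE; apply/idP/orP.
    have [<- | neq_uw] := eqVneq u w.
      by rewrite infl_adj_same => ag; left; rewrite imset_f // inE.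
    rewrite infl_adj_neq // => /eqP eq_g; right; apply/imsetP; exists w.
      by rewrite !inE eq_sym.
    by rewrite -eq_g psiK.
  case=> /imsetP[t]; rewrite !inE.
    by move=> ag [-> ->]; rewrite infl_adj_same.
  by move=> neq_tu [-> ->]; rewrite infl_adj_neq 1?eq_sym // phiK.
rewrite cardsU disjoint_setI0 ?cards0 ?subn0.
  rewrite !card_imset ?degG ?cardsC1 //.
    by move=> w w' [].
  by move=> g g' [].
rewrite -setI_eq0; apply/eqP/setP => -[w g]; rewrite !inE.
apply/negP => /andP[/imsetP[? _ [-> _]] /imsetP[t]].
by rewrite !inE => neq_tu [eq_ut _]; rewrite eq_ut eqxx in neq_tu.
Qed.

Lemma card_inflation : #|inflation| = 2 * #|G| ^ 2.
Proof.
rewrite /= !card_prod card_bool -(bij_eq_card phi_bij) /=.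
by rewrite -mulnA mulnCA mulnn.
Qed.

End Inflation.

(** * Membership in [W_5] *)

(** The invariant of the recursion: it admits the starting graph K_2, which is a star of diameter
    1. *)
Definition pre_W5 (G : sgraph) : Prop :=
  [/\ regular G, triangle_free G, codegree_le 4 G & diameter_le2 G].

Lemma pre_W5_exists (e : nat) :
  exists2 G : sgraph, pre_W5 G & #|G| = 2 ^ (2 ^ e.+1 - 1).
Proof.
elim: e => [|e [G [regG tfG cdG dG] cardG]].
  have neq_sym : symmetric (fun x y : bool => x != y) by move=> x y; rewrite eq_sym.
  have neq_irr : irreflexive (fun x y : bool => x != y) by move=> x; rewrite eqxx.
  exists (SGraph neq_sym neq_irr); last by rewrite /= card_bool.
  split.
  - exists 1 => x; rewrite -[RHS](cards1 (~~ x)); apply: eq_card => y.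
    by rewrite !inE; case: x y => [] [].
  - by move=> [] [] [].
  - by move=> x y _; apply: leq_trans (max_card _) _; rewrite card_bool.
  - by move=> [] [].
have odd_n : odd (2 ^ e.+1 - 1) by rewrite oddB ?expn_gt0 // oddX.
have [F [cardF char2 ncr]] := exists_crooked_field odd_n.
have eq_card : #|G| = #|F| by rewrite cardG cardF.
have [phi phi_bij] : exists phi : G -> F, bijective phi.
  exists (fun x => enum_val (cast_ord eq_card (enum_rank x))).
  exists (fun y => enum_val (cast_ord (esym eq_card) (enum_rank y))) => x.
    by rewrite enum_valK cast_ordK enum_rankK.
  by rewrite enum_valK cast_ordKV enum_rankK.
exists (inflation phi).
  split; [exact: infl_regular | exact: infl_triangle_free |
          exact: infl_codegree_le | exact: infl_diameter_le2].
(* With n = 2^(e+1) - 1, the new exponent is 2n + 1 = 2^(e+2) - 1. *)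
rewrite (card_inflation phi_bij) cardG -expnM -expnS; congr (2 ^ _).
rewrite [in RHS]expnS; have := expn_gt0 2 e.+1; lia.
Qed.

(** With at least two leaves, the centre has larger degree than a leaf. *)
Lemma regular_not_star (G : sgraph) : regular G -> 2 < #|G| -> ~ is_star G.
Proof.
move=> [k degG] cardG [m [f [f_bij fE]]].
have degE x : #|[set y | @adj (complete_bipartite 1 m) x y]| = k.
  rewrite -(degG (f x)) -(card_imset _ (bij_inj f_bij)).
  have [g fK gK] := f_bij.
  apply: eq_card => y; rewrite inE; apply/imsetP/idP => [[z] | xy].
    by rewrite inE fE => xz ->.
  by exists (g y); rewrite ?gK // inE fE gK.
have cardGE : #|G| = 1 + m by rewrite -(bij_eq_card f_bij) card_sum !card_ord.
case: m f f_bij fE degE cardGE => [|[|m]] f f_bij fE degE cardGE;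
  try by rewrite cardGE in cardG.
have center : #|[set y | @adj (complete_bipartite 1 m.+2) (inl ord0) y]| = m.+2.
  rewrite -[RHS]card_ord -(card_imset _ (@inr_inj 'I_1 'I_m.+2)).
  apply: eq_card => -[y|y]; rewrite !inE /=.
    by apply/esym/negP => /imsetP[].
  by apply/esym/imsetP; exists y.
have leaf : #|[set y | @adj (complete_bipartite 1 m.+2) (inr ord0) y]| = 1.
  rewrite -[RHS](cards1 (inl ord0 : 'I_1 + 'I_m.+2)); apply: eq_card => -[y|y].
    by rewrite !inE /= (ord1 y) eqxx.
  by rewrite !inE.
by have := degE (inr ord0); rewrite leaf -(degE (inl ord0)) center.
Qed.

Lemma triangle_free_no_C3 (G : sgraph) :
  triangle_free G -> ~ embeds (cycle_graph 3) G.
Proof.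
move=> tfG [f [_ fE]].
pose v (i : nat) : cycle_graph 3 := inord i.
have adj_v i j : i < j < 3 -> adj (f (v i)) (f (v j)).
  case: i j => [|[|[|i]]] [|[|[|j]]]; rewrite ?andbF // => _;
    by apply: fE; rewrite /= /cycle_adj -!val_eqE /= !inordK.
by have /negP[] := tfG _ _ _ (adj_v 0 1 isT) (adj_v 1 2 isT); apply: adj_v.
Qed.

Lemma codegree_le_no_K2 (k : nat) (G : sgraph) :
  codegree_le k G -> ~ embeds (complete_bipartite 2 k.+1) G.
Proof.
move=> cdG [f [f_inj fE]].
pose x : complete_bipartite 2 k.+1 := inl ord0.
pose y : complete_bipartite 2 k.+1 := inl ord_max.
have neq_xy : f x != f y by rewrite (inj_eq f_inj).
have := cdG _ _ neq_xy; rewrite leqNgt => /negP[].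
rewrite -[X in X <= _]card_ord.
rewrite -(card_imset predT (f := fun i : 'I_k.+1 => f (inr i))).
  apply/subset_leq_card/subsetP => _ /imsetP[i _ ->].
  by rewrite inE !fE.
by move=> i j /f_inj[].
Qed.

Lemma diameter_le2_has_diameter (G : sgraph) : triangle_free G ->
  diameter_le2 G -> 2 < #|G| -> has_diameter G 2.
Proof.
move=> tfG dG cardG.
have dist2 (x y : G) : x != y -> ~~ adj x y -> has_distance x y 2.
  move=> neq_xy nadj_xy; split.
    have [z /andP[xz yz]] := dG _ _ neq_xy nadj_xy.
    by exists [:: z; y]; rewrite /= xz adj_sym yz.
  move=> [|[|j]] // [p [xp lastp sizep]].
    by case: p xp lastp sizep => //= _ eq_xy; rewrite eq_xy eqxx in neq_xy.
  case: p xp lastp sizep => [|z [|? ?]] //= /andP[xz _] eq_zy _.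
  by rewrite -eq_zy xz in nadj_xy.
split=> [x y|].
  have [<- | neq_xy] := eqVneq x y.
    by exists 0 => //; split=> //; exists [::].
  have [xy | nadj_xy] := boolP (adj x y); last by exists 2 => //; apply: dist2.
  exists 1 => //; split; first by exists [:: y]; rewrite /= xy.
  move=> [|j] // [p [_ lastp sizep]].
  by case: p lastp sizep => //= eq_xy; rewrite eq_xy eqxx in neq_xy.
(* Among any three vertices some two are nonadjacent, so distance 2 is attained. *)
have /card_gt2P[x [y [z [_ [xy yz zx]]]]] : 2 < #|[set: G]| by rewrite cardsT.
have [axy | nxy] := boolP (adj x y); last by exists x, y; apply: dist2.
have [ayz | nyz] := boolP (adj y z); last by exists y, z; apply: dist2.
by exists x, z; apply: dist2; [rewrite eq_sym | apply: tfG ayz].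
Qed.

Theorem theorem1p3 (e : nat) (he : 2 <= e) :
  exists G : sgraph, [/\ regular G, in_W 5 G & #|G| = 2 ^ (2 ^ e - 1)].
Proof.
case: e he => [//|e] he.
have [G [regG tfG cdG dG] cardG] := pre_W5_exists e.
have card_gt2 : 2 < #|G|.
  (* The smallest exponent that occurs is 2^2 - 1 = 3. *)
  rewrite cardG; apply: (@leq_trans (2 ^ 3)) => //.
  by rewrite leq_exp2l // leq_subRL ?expn_gt0 // (@leq_exp2l 2 2).
exists G; split=> //; split.
- exact: regular_not_star.
- exact: diameter_le2_has_diameter.
- exact: triangle_free_no_C3.
- exact: codegree_le_no_K2.
Qed.
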